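(* Let $\varepsilon>0$. Suppose there is a constant $C_\varepsilon$ such that $\sum_n r_{E+E}(n)^2\le C_\varepsilon |E|^{2+\varepsilon}$ for every finite set $E$ of squares. Then there is a constant $c_\varepsilon>0$ such that $|E+E|\ge c_\varepsilon |E|^{2-\varepsilon}$ for every finite set $E$ of squares. (In particular, if the first bound holds for every $\varepsilon>0$, then so does the second.)
   Context: A square is the square of an integer. For a finite set $E$ of integers, $E+E=\{x+y: x,y\in E\}$ and $r_{E+E}(n)=\#\{(x,y)\in E\times E: x+y=n\}$. *)

(* Defs.v *)
From mathcomp Require Import all_boot all_order all_algebra.
From mathcomp Require Import finmap.
From mathcomp Require Import all_classical all_reals all_analysis.

Set Implicit Arguments.
Unset Strict Implicit.
Unset Printing Implicit Defensive.

Import Order.TTheory GRing.Theory Num.Theory.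

Local Open Scope fset_scope.
Local Open Scope ring_scope.

Definition is_square (n : int) : Prop := exists m : int, n = m ^+ 2.

Definition set_of_squares (E : {fset int}) : Prop :=
  forall n : int, n \in E -> is_square n.

Definition sumset (E : {fset int}) : {fset int} :=
  [fset x + y | x in E, y in E].

Definition sum_rep (E : {fset int}) (n : int) : nat :=
  #|` [fset p in E `*` E | p.1 + p.2 == n]|.

(* The sum runs over all integers; it has finite support, since
   [sum_rep E n] vanishes for n outside [sumset E]. *)
Definition additive_energy (E : {fset int}) : nat :=
  (\sum_(n \in [set: int]) (sum_rep E n ^ 2)%N)%N.

Definition energy_bound (R : realType) (eps : R) : Prop :=
  exists C : R, forall E : {fset int}, set_of_squares E ->
    (additive_energy E)%:R <= C * #|` E|%:R `^ (2 + eps).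

(* The expression 0 ^ (2 - eps) is meaningless (or, for eps = 2, conventionally
   1, making the inequality false) when 2 <= eps, so the empty set is only
   considered when eps < 2. *)
Definition sumset_bound (R : realType) (eps : R) : Prop :=
  exists2 c : R, 0 < c & forall E : {fset int}, set_of_squares E ->
    E != fset0 \/ eps < 2 ->
    c * #|` E|%:R `^ (2 - eps) <= #|` sumset E|%:R.

(* Main.v *)
Require Import Defs.
From mathcomp Require Import all_boot all_order all_algebra.
From mathcomp Require Import finmap.
From mathcomp Require Import all_classical all_reals all_analysis.

Set Implicit Arguments.
Unset Strict Implicit.
Unset Printing Implicit Defensive.

Import Order.TTheory GRing.Theory Num.Theory.
Local Open Scope ring_scope.

(** Summing [sum_rep E] over the sumset counts all of [E * E], so the
    Cauchy-Schwarz inequality gives [|E|^4 <= |E + E| * additive_energy E].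
    Inserting the energy bound [C |E|^(2 + eps)] and dividing by it yields
    the claim with [c = 1 / C]. *)

Lemma sum_nat_const_seq (I : Type) (s : seq I) (n : nat) :
  (\sum_(i <- s) n = size s * n)%N.
Proof. by rewrite big_const_seq count_predT iter_addn_0 mulnC. Qed.

(** Cauchy-Schwarz against the constant 1. After doubling, both sides become double sums over [s],
    compared term by term through [2 * (a * b) <= a ^ 2 + b ^ 2]. *)
Lemma leq_sqr_sum (I : Type) (s : seq I) (f : I -> nat) :
  ((\sum_(i <- s) f i) ^ 2 <= size s * \sum_(i <- s) f i ^ 2)%N.
Proof.
rewrite -(leq_pmul2l (isT : 0 < 2)%N) -mulnn big_distrlr big_distrr /=.
have -> : (2 * (size s * \sum_(i <- s) f i ^ 2) =
    \sum_(i <- s) \sum_(j <- s) (f i ^ 2 + f j ^ 2))%N.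
  under [RHS]eq_bigr do rewrite big_split /= sum_nat_const_seq.
  by rewrite big_split /= sum_nat_const_seq -big_distrr addnn mul2n.
apply: leq_sum => i _; rewrite big_distrr /=.
by apply: leq_sum => j _; exact: nat_Cauchy.
Qed.

Lemma card_fsetM (K K' : choiceType) (A : {fset K}) (B : {fset K'}) :
  #|` (A `*` B)%fset| = (#|` A| * #|` B|)%N.
Proof.
rewrite card_fset_sum1 big_imfset2 /=; last by move=> [? ?] [? ?] _ _ /= [-> ->].
under eq_bigr do rewrite -card_fset_sum1.
by rewrite sum_nat_const_seq.
Qed.

(** As the image of one map on pairs, the sumset indexes the fibres of addition on [E * E]. *)
Lemma sumsetE (E : {fset int}) :
  sumset E = [fset (p.1 + p.2)%R | p in E `*` E]%fset.
Proof.
apply/fsetP => n; apply/imfset2P/imfsetP => /=.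
  by move=> [x xE [y yE ->]]; exists (x, y); rewrite // in_fsetM xE.
by move=> [[x y]]; rewrite in_fsetM => /andP[xE yE] ->; exists x => //; exists y.
Qed.

Lemma sum_repE (E : {fset int}) (n : int) :
  sum_rep E n = (\sum_(p <- (E `*` E)%fset | (p.1 + p.2 == n)%R) 1)%N.
Proof. by rewrite /sum_rep card_fset_sum1 big_fset. Qed.

Lemma sum_rep_notin (E : {fset int}) (n : int) :
  n \notin sumset E -> sum_rep E n = 0%N.
Proof.
rewrite sumsetE sum_repE => nS; rewrite big_seq_cond big_pred0 // => p.
apply: contraNF nS => /andP[pE /eqP <-].
by apply/imfsetP; exists p.
Qed.

Lemma additive_energyE (E : {fset int}) :
  additive_energy E = (\sum_(n <- sumset E) sum_rep E n ^ 2)%N.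
Proof. by rewrite /additive_energy; apply: fsbigTE => n /sum_rep_notin ->. Qed.

(** The pairs in [E * E] are partitioned by their sum, and the fibre over [n] has [sum_rep E n]
    elements. *)
Lemma sum_sum_rep (E : {fset int}) :
  (\sum_(n <- sumset E) sum_rep E n = #|` E| ^ 2)%N.
Proof.
rewrite -mulnn -card_fsetM card_fset_sum1 sumsetE.
rewrite (partition_big_imfset _ (fun p : int * int => p.1 + p.2)).
by apply: eq_bigr => n _; rewrite sum_repE.
Qed.

Lemma card_sumset_energy (E : {fset int}) :
  (#|` E| ^ 4 <= #|` sumset E| * additive_energy E)%N.
Proof.
rewrite (expnM _ 2 2) -sum_sum_rep additive_energyE; exact: leq_sqr_sum.
Qed.

Lemma energy_sumset_bound (R : realType) (eps : R) :
  energy_bound eps -> sumset_bound eps.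
Proof.
(* The hypothesis does not state the sign of [C]; [D] is visibly positive and still satisfies the
   energy bound, so [D^-1] serves as [c]. *)
move=> [C hC]; pose D := Num.max C 1.
have D_gt0 : 0 < D by rewrite lt_max ltr01 orbT.
exists D^-1 => [|E sqE]; first by rewrite invr_gt0.
(* For empty [E] the side condition leaves [eps < 2], so the exponent is nonzero and the power of 0
   is 0. *)
have [-> [//|eps_lt2] | E_neq0 _] := eqVneq E fset0.
  by rewrite cardfs0 powR0 ?mulr0 ?ler0n// subr_eq0 gt_eqF.
set x : R := #|` E|%:R.
have x_gt0 : 0 < x by rewrite ltr0n cardfs_gt0.
rewrite mulrC ler_pdivrMr // -(ler_pM2r (powR_gt0 (2 + eps) x_gt0)).
rewrite -powRD ?(gt_eqF x_gt0) ?implybT//.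
have -> : 2 - eps + (2 + eps) = 4%:R by rewrite addrCA subrK -natrD.
rewrite powR_mulrn ?(ltW x_gt0)// -natrX.
apply: (@le_trans _ _ (#|` sumset E| * additive_energy E)%:R).
  by rewrite ler_nat card_sumset_energy.
rewrite natrM -mulrA ler_wpM2l ?ler0n//.
apply: le_trans (hC E sqE) _.
by rewrite ler_wpM2r ?powR_ge0// le_max lexx.
Qed.

Theorem theorem3 (R : realType) :
  (forall eps : R, 0 < eps -> energy_bound eps -> sumset_bound eps) /\
  ((forall eps : R, 0 < eps -> energy_bound eps) ->
   forall eps : R, 0 < eps -> sumset_bound eps).
Proof.
split=> [eps _ | bnd eps eps_gt0]; first exact: energy_sumset_bound.
exact/energy_sumset_bound/bnd.
Qed.
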